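(* Let $H$ be the unrolled control-flow graph of a program $S$ (possibly containing while loops). For each node $M$ of $H$ and each program variable $x$ there exists an evaluation function $$V^M_x\in[\mathcal T|_{\mathrm{prov}(M,x)}\to\mathcal V]$$ (with $\mathrm{prov}(M,x)$ computed in $H$) such that for all traces $\mathtt{tr}$, for the initial state $\sigma_0$ mapping all program variables to $\mathtt{null}$ and $\mathbf p$ to $1$, and for the execution sequence $$(\sigma_0,\mathrm{START})\xrightarrow{\mathtt{tr}}\cdots\xrightarrow{\mathtt{tr}}(\sigma_i,M_i)\xrightarrow{\mathtt{tr}}\cdots\xrightarrow{\mathtt{tr}}(\sigma_l,\mathrm{END})$$ in $H$ (whenever it exists), we have $\sigma_i(x)=V^{M_i}_x(\mathtt{tr})$ for all $i$ and all program variables $x$.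
   Context: **Language.** $\mathcal V$ is the set of values (booleans, integers, reals, real vectors, finite strings, and a special value $\mathtt{null}$); $\mathbf{Strings}\subset\mathcal V$ is the set of finite strings (addresses). Expressions: $E::=c\mid x\mid g(E_1,\dots,E_n)$ with $c\in\mathcal V$ a constant, $x$ a program variable (finitely many), $g$ a built-in total function on values. $\mathrm{vars}(E)$ is the set of program variables in $E$. Statements: $S::= x=E\mid S_1;S_2\mid \mathtt{if}\,E\,\mathtt{then}\,S_1\,\mathtt{else}\,S_2\mid\mathtt{skip}\mid\mathtt{while}\,E\,\mathtt{do}\,S\mid x=\mathtt{sample}(E_0,f(E_1,\dots,E_n))$, with $f$ a built-in distribution having a function $\mathrm{pdf}_f(v;v_1,\dots,v_n)\in\mathbb R_{\ge0}$. The address expression $E_0$ is assumed to evaluate to a string. A program is a statement. **Traces and states.** A trace is a map $\mathtt{tr}:\mathbf{Strings}\to\mathcal V$; $\mathcal T$ is the set of all traces. A state $\sigma\in\Sigma$ assigns a value to every program variable and a number in $\mathbb R_{\ge0}$ to a reserved variable $\mathbf p$ (not a program variable, not occurring in programs); it is lifted to expressions by $\sigma(c)=c$, $\sigma(g(E_1,\dots,E_n))=g(\sigma(E_1),\dots,\sigma(E_n))$. **Unrolled CFG.** The unrolled control-flow graph $H$ of $S$ is a directed acyclic graph (with possibly infinitely many nodes) with one START, one END node, and branch nodes $\mathrm{Branch}(E)$, join nodes, assign nodes $\mathrm{Assign}(x=E)$ and sample nodes $\mathrm{Assign}(x=\mathtt{sample}(\dots))$ (sample nodes are also assign nodes). Every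 occurrence of a statement yields its own nodes. $\mathtt{skip}$: START$\to$END. Assignment/sample: START$\to$Assign$\to$END. $S_1;S_2$: remove END of the graph $H_1$ of $S_1$ and START of the graph $H_2$ of $S_2$ and connect the predecessor of END in $H_1$ to the successor of START in $H_2$. $\mathtt{if}\,E\,\mathtt{then}\,S_1\,\mathtt{else}\,S_2$: START$\to B=\mathrm{Branch}(E)$; $B$ has successors consequent$(B)$ = first node of (the interior of) $H_1$, alternative$(B)$ = first node of $H_2$; the last nodes of $H_1$, $H_2$ go to a join node $J$; $J\to$END (a $\mathtt{skip}$ branch is a direct edge $B\to J$); $(B,J)\in\mathrm{BranchJoin}(H)$. $\mathtt{while}\,E\,\mathtt{do}\,S'$: for every $i\in\mathbb N$, $i\ge1$, take a branch node $B_i=\mathrm{Branch}(E)$ and a copy $H_i$ of the unrolled CFG of $S'$, and a single join node $J$; edges START$\to B_1$, consequent$(B_i)$ = first node of $H_i$, alternative$(B_i)=J$, last node of $H_i\to B_{i+1}$, $J\to$END (if $S'=\mathtt{skip}$, edges $B_i\to B_{i+1}$); $(B_i,J)\in\mathrm{BranchJoin}(H)$ for all $i$. For a branch node $B=\mathrm{Branch}(E)$, $\mathrm{condexp}(B)=E$. **Graph semantics.** Transitions $(\sigma,N)\xrightarrow{\mathtt{tr}}(\sigma',N')$: START and join nodes move to their successor with $\sigma'=\sigma$; $\mathrm{Assign}(x=E)$ moves to its successor with $\sigma'=\sigma[x\mapsto\sigma(E)]$; $\mathrm{Assign}(x=\mathtt{sample}(E_0,f(E_1,\dots,E_n)))$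 moves to its successor, provided $V_i=\sigma(E_i)\ne\mathtt{null}$ for all $i=0,\dots,n$, $V_0\in\mathbf{Strings}$ and $V=\mathtt{tr}(V_0)\ne\mathtt{null}$, with $\sigma'=\sigma[x\mapsto V,\mathbf p\mapsto\sigma(\mathbf p)\cdot\mathrm{pdf}_f(V;V_1,\dots,V_n)]$; $\mathrm{Branch}(E)$ moves with $\sigma'=\sigma$ to consequent if $\sigma(E)=\mathtt{true}$, to alternative if $\sigma(E)=\mathtt{false}$. **Provenance.** $\mathrm{RD}(N,x)$ is the set of assign nodes $N'$ assigning $x$ (including sample nodes) for which there is a path $(N',N_1,\dots,N_n,N)$, $n\ge0$, with no $N_i$ assigning $x$. $\mathrm{BP}(N)=\{B:(B,J)\in\mathrm{BranchJoin}(H),\ \exists\text{ path }(B,\dots,N,\dots,J)\}$. For a sample node with address expression $E_0$, $\mathrm{addresses}(N)=\{\sigma(E_0):\sigma\in\Sigma\}\cap\mathbf{Strings}$. $\mathrm{prov}(N,x)$: let $R$ be the least set of pairs containing $(N,x)$ such that whenever $(M,z)\in R$ and $N'\in\mathrm{RD}(M,z)$, then (i) $(N',y)\in R$ for all $y\in\mathrm{vars}(E')$, where $E'=E$ if $N'=\mathrm{Assign}(z=E)$ and $E'=E_0$ if $N'=\mathrm{Assign}(z=\mathtt{sample}(E_0,\dots))$; (ii) $(B,y)\in R$ for all $B\in\mathrm{BP}(N')$, $y\in\mathrm{vars}(\mathrm{condexp}(B))$. Then $\mathrm{prov}(N,x)$ is the union of $\mathrm{addresses}(N')$ over all sample nodes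 $N'\in\mathrm{RD}(M,z)$ with $(M,z)\in R$. **Restricted functions.** For $A\subseteq\mathbf{Strings}$ and a set $C$, $[\mathcal T|_A\to C]$ is the set of functions $h:\mathcal T\to C$ such that $h(\mathtt{tr})=h(\mathtt{tr}')$ whenever $\mathtt{tr}(\alpha)=\mathtt{tr}'(\alpha)$ for all $\alpha\in A$. *)

(* Defs.v *)
From Stdlib Require Import String.
From mathcomp Require Import all_boot all_order all_algebra.
From mathcomp Require Import boolp classical_sets reals interval_inference.

Set Implicit Arguments.
Unset Strict Implicit.
Unset Printing Implicit Defensive.

Import Order.TTheory GRing.Theory Num.Theory.

Local Open Scope classical_set_scope.
Local Open Scope ring_scope.

Inductive value (R : realType) : Type :=
| VBool of bool
| VInt of int
| VReal of R
| VVec of seq R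
| VStr of string
| VNull.
Arguments VBool {R} b.
Arguments VInt {R} z.
Arguments VReal {R} r.
Arguments VVec {R} v.
Arguments VStr {R} s.
Arguments VNull {R}.

Record builtins (R : realType) : Type := Builtins {
  fsym : Type;
  farity : fsym -> nat;
  fsem : forall g : fsym, (farity g).-tuple (value R) -> value R;
  dsym : Type;
  darity : dsym -> nat;
  (* [pdf f v vs] is the density of the distribution f with parameters vs
     at the point v. *)
  pdf : forall f : dsym,
    value R -> (darity f).-tuple (value R) -> {nonneg R} }.
Arguments fsem {R} b g.
Arguments pdf {R} b f.

Section Syntax.
Variables (R : realType) (L : builtins R) (X : finType).

Inductive expr : Type :=
| EConst of value R
| EVar of X
| EApp (g : fsym L) of ('I_(farity g) -> expr).

Fixpoint vars (E : expr) : set X :=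
  match E with
  | EConst _ => set0
  | EVar x => [set x]
  | EApp _ Es => \bigcup_i vars (Es i)
  end.

(* [SSample x E0 f Es] is  x = sample(E0, f(Es)). *)
Inductive stmt : Type :=
| SAssign of X & expr
| SSeq of stmt & stmt
| SIf of expr & stmt & stmt
| SSkip
| SWhile of expr & stmt
| SSample (x : X) (E0 : expr) (f : dsym L) of ('I_(darity f) -> expr).

Definition trace : Type := string -> value R.

(* The reserved variable p is the separate field [density]. *)
Record state : Type := State {
  store : X -> value R;
  density : {nonneg R} }.

Fixpoint eval (s : state) (E : expr) : value R :=
  match E with
  | EConst c => c
  | EVar x => store s x
  | EApp g Es => fsem L g [tuple eval s (Es i) | i < farity g]
  end.

Definition upd (s : X -> value R) (x : X) (v : value R) : X -> value R :=
  fun y => if y == x then v else s y.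

Definition init_state : state := State (fun=> VNull) 1%:nng.

Inductive label : Type :=
| LBranch of expr
| LJoin
| LAssign of X & expr
| LSample (x : X) (E0 : expr) (f : dsym L) of ('I_(darity f) -> expr).

End Syntax.

Arguments LJoin {R L X}.
Arguments SSkip {R L X}.
Arguments EConst {R L X}.
Arguments EVar {R L X}.

Inductive node (T : Type) : Type := START | END | Inner of T.
Arguments START {T}.
Arguments END {T}.

(* A graph has START, END and the inner nodes of type [inner].
   [edge H u k v] is an edge from u to v.  For a branch node u, the tag k is
   [Some true] if v = consequent(u) and [Some false] if v = alternative(u);
   the edge leaving any other node has tag [None]. *)
Record cfg (R : realType) (L : builtins R) (X : finType) : Type := Cfg {
  inner : Type;
  lab : inner -> label L X;
  edge : node inner -> option bool -> node inner -> Prop;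
  branch_join : inner -> inner -> Prop }.

Arguments edge {R L X} c.

(* Renames inner nodes by f, START to s and END to e. *)
Definition embed (A B : Type) (s e : node B) (f : A -> B) (u : node A) :
    node B :=
  match u with
  | START => s
  | END => e
  | Inner a => Inner (f a)
  end.

Section Graphs.
Variables (R : realType) (L : builtins R) (X : finType).
Notation cfg := (cfg L X).

Definition skip_cfg : cfg :=
  @Cfg R L X void (fun v => match v with end)
    (fun u k v => [/\ u = START, k = None & v = END])
    (fun _ _ => False).

Inductive single_edge : node unit -> option bool -> node unit -> Prop :=
| SingleIn : single_edge START None (Inner tt)
| SingleOut : single_edge (Inner tt) None END.

Definition single_cfg (l : label L X) : cfg :=
  @Cfg R L X unit (fun=> l) single_edge (fun _ _ => False).

Section Seq.
Variables H1 H2 : cfg.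
Let T : Type := (inner H1 + inner H2)%type.
Definition seq_left : node (inner H1) -> node T := embed START END inl.
Definition seq_right : node (inner H2) -> node T := embed START END inr.

Inductive seq_edge : node T -> option bool -> node T -> Prop :=
| SeqLeft u k a :
    edge H1 u k (Inner a) -> seq_edge (seq_left u) k (seq_left (Inner a))
| SeqLink u k k' v :
    edge H1 u k END -> edge H2 START k' v ->
    seq_edge (seq_left u) k (seq_right v)
| SeqRight b k v :
    edge H2 (Inner b) k v -> seq_edge (seq_right (Inner b)) k (seq_right v).

Inductive seq_branch_join : T -> T -> Prop :=
| SeqBJLeft b j : branch_join b j -> seq_branch_join (inl b) (inl j)
| SeqBJRight b j : branch_join b j -> seq_branch_join (inr b) (inr j).

Definition seq_cfg : cfg :=
  @Cfg R L X T
    (fun n => match n with inl a => lab a | inr b => lab b end)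
    seq_edge seq_branch_join.
End Seq.

Inductive if_inner (A B : Type) : Type :=
| IfBranch | IfJoin | IfThen of A | IfElse of B.
Arguments IfBranch {A B}.
Arguments IfJoin {A B}.
Arguments IfThen {A B} a.
Arguments IfElse {A B} b.

Section If.
Variables (E : expr L X) (H1 H2 : cfg).
Let T : Type := if_inner (inner H1) (inner H2).
Definition if_then : node (inner H1) -> node T :=
  embed (Inner IfBranch) (Inner IfJoin) IfThen.
Definition if_else : node (inner H2) -> node T :=
  embed (Inner IfBranch) (Inner IfJoin) IfElse.

Inductive if_edge : node T -> option bool -> node T -> Prop :=
| IfEnter : if_edge START None (Inner IfBranch)
| IfConsequent k v :
    edge H1 START k v -> if_edge (Inner IfBranch) (Some true) (if_then v)
| IfAlternative k v :
    edge H2 START k v -> if_edge (Inner IfBranch) (Some false) (if_else v)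
| IfInThen a k v :
    edge H1 (Inner a) k v -> if_edge (if_then (Inner a)) k (if_then v)
| IfInElse b k v :
    edge H2 (Inner b) k v -> if_edge (if_else (Inner b)) k (if_else v)
| IfExit : if_edge (Inner IfJoin) None END.

Inductive if_branch_join : T -> T -> Prop :=
| IfBJ : if_branch_join IfBranch IfJoin
| IfBJThen b j : branch_join b j -> if_branch_join (IfThen b) (IfThen j)
| IfBJElse b j : branch_join b j -> if_branch_join (IfElse b) (IfElse j).

Definition if_cfg : cfg :=
  @Cfg R L X T
    (fun n => match n with
              | IfBranch => LBranch E
              | IfJoin => LJoin
              | IfThen a => lab a
              | IfElse b => lab b
              end)
    if_edge if_branch_join.
End If.

Inductive while_inner (A : Type) : Type :=
| WhileBranch of nat | WhileJoin | WhileBody of nat & A.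
Arguments WhileBranch {A} i.
Arguments WhileJoin {A}.
Arguments WhileBody {A} i a.

Section While.
Variables (E : expr L X) (H : cfg).
Let T : Type := while_inner (inner H).
(* START and END of the i-th copy of H are merged with the branch nodes of
   the i-th and (i+1)-st iteration, iterations being numbered from 0. *)
Definition while_copy (i : nat) : node (inner H) -> node T :=
  embed (Inner (WhileBranch i)) (Inner (WhileBranch i.+1)) (WhileBody i).

Inductive while_edge : node T -> option bool -> node T -> Prop :=
| WhileEnter : while_edge START None (Inner (WhileBranch 0%N))
| WhileConsequent i k v :
    edge H START k v ->
    while_edge (Inner (WhileBranch i)) (Some true) (while_copy i v)
| WhileAlternative i :
    while_edge (Inner (WhileBranch i)) (Some false) (Inner WhileJoin)
| WhileInBody i a k v :
    edge H (Inner a) k v ->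
    while_edge (while_copy i (Inner a)) k (while_copy i v)
| WhileExit : while_edge (Inner WhileJoin) None END.

Inductive while_branch_join : T -> T -> Prop :=
| WhileBJ i : while_branch_join (WhileBranch i) WhileJoin
| WhileBJBody i b j :
    branch_join b j -> while_branch_join (WhileBody i b) (WhileBody i j).

Definition while_cfg : cfg :=
  @Cfg R L X T
    (fun n => match n with
              | WhileBranch _ => LBranch E
              | WhileJoin => LJoin
              | WhileBody _ a => lab a
              end)
    while_edge while_branch_join.
End While.

Fixpoint unrolled_cfg (S : stmt L X) : cfg :=
  match S with
  | SAssign x E => single_cfg (LAssign x E)
  | SSeq S1 S2 => seq_cfg (unrolled_cfg S1) (unrolled_cfg S2)
  | SIf E S1 S2 => if_cfg E (unrolled_cfg S1) (unrolled_cfg S2)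
  | SSkip => skip_cfg
  | SWhile E S1 => while_cfg E (unrolled_cfg S1)
  | SSample x E0 f Es => single_cfg (LSample x E0 Es)
  end.

End Graphs.

Section Semantics.
Variables (R : realType) (L : builtins R) (X : finType) (H : cfg L X).
Notation node := (node (inner H)).

Inductive step (tr : trace R) :
    state R X * node -> state R X * node -> Prop :=
| StepStart s v :
    edge H START None v -> step tr (s, START) (s, v)
| StepJoin s n v :
    lab n = LJoin -> edge H (Inner n) None v -> step tr (s, Inner n) (s, v)
| StepAssign s n x E v :
    lab n = LAssign x E -> edge H (Inner n) None v ->
    step tr (s, Inner n)
      (State (upd (store s) x (eval s E)) (density s), v)
| StepSample s n x E0 f (Es : 'I_(darity f) -> expr L X) (alpha : string) v :
    lab n = LSample x E0 Es -> edge H (Inner n) None v ->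
    eval s E0 = VStr alpha ->
    (forall i, eval s (Es i) <> VNull) ->
    tr alpha <> VNull ->
    step tr (s, Inner n)
      (State (upd (store s) x (tr alpha))
         ((density s)%:num *
          (pdf L f (tr alpha) [tuple eval s (Es i) | i < darity f])%:num)%:nng,
       v)
| StepBranch s n E b v :
    lab n = LBranch E -> edge H (Inner n) (Some b) v ->
    eval s E = VBool b ->
    step tr (s, Inner n) (s, v).

(* The configurations c 0, ..., c l form an execution sequence from the initial
   state to END; the values of c beyond l are irrelevant. *)
Definition execution (tr : trace R) (l : nat) (c : nat -> state R X * node) :
    Prop :=
  [/\ c 0%N = (init_state R X, START),
      forall i, (i < l)%N -> step tr (c i) (c i.+1)
    & (c l).2 = END].

(* Paths (u, N_1, ..., N_n, v), n >= 0, all of whose N_i satisfy P. *)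
Inductive path_via (P : node -> Prop) : node -> node -> Prop :=
| PathEdge u k v : edge H u k v -> path_via P u v
| PathCons u k w v :
    edge H u k w -> P w -> path_via P w v -> path_via P u v.

Definition assigns (x : X) (u : node) : Prop :=
  match u with
  | Inner n =>
      match lab n with
      | LAssign y _ => y = x
      | LSample y _ _ _ => y = x
      | _ => False
      end
  | _ => False
  end.

Definition RD (M : node) (x : X) : set (inner H) :=
  [set N | assigns x (Inner N) /\
           path_via (fun u => ~ assigns x u) (Inner N) M].

Definition BP (N : node) : set (inner H) :=
  [set B | exists J, [/\ branch_join B J,
                         path_via (fun=> True) (Inner B) N
                       & path_via (fun=> True) N (Inner J)]].

Definition addresses (N : inner H) : set string :=
  [set alpha | match lab N with
               | LSample _ E0 _ _ => exists s : state R X, eval s E0 = VStr alpha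
               | _ => False
               end].

(* For a sample node only the variables of the address expression count, not
   those of the distribution parameters. *)
Definition used_vars (N : inner H) : set X :=
  match lab N with
  | LAssign _ E => vars E
  | LSample _ E0 _ _ => vars E0
  | _ => set0
  end.

Definition cond_vars (B : inner H) : set X :=
  match lab B with
  | LBranch E => vars E
  | _ => set0
  end.

Inductive prov_rel (N : node) (x : X) : node -> X -> Prop :=
| ProvBase : prov_rel N x N x
| ProvAssign M z N' y :
    prov_rel N x M z -> RD M z N' -> used_vars N' y ->
    prov_rel N x (Inner N') y
| ProvBranch M z N' B y :
    prov_rel N x M z -> RD M z N' -> BP (Inner N') B -> cond_vars B y ->
    prov_rel N x (Inner B) y.

Definition prov (N : node) (x : X) : set string :=
  [set alpha | exists M z N',
     [/\ prov_rel N x M z, RD M z N' & addresses N' alpha]].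

End Semantics.

(* [T|_A -> C], T being the set of all traces. *)
Definition restricted_fun (R : realType) (C : Type) (A : set string) :
    set (trace R -> C) :=
  [set h | forall tr tr' : trace R,
     (forall alpha, A alpha -> tr alpha = tr' alpha) -> h tr = h tr'].

(* Main.v *)
(* The unrolled graph is acyclic, so an execution visits each node at most once,
   and every branch node is postdominated by its join node.  Take two complete
   executions through M under traces agreeing on prov(M,x).  If one of them
   visits an assign node N and the other does not, the last node before N that
   both visit is a branch node in BP(N) at which the conditions differ.  By
   induction on the position in the execution, the conditions of the branches
   in BP(N) agree, so both executions have the same last assign node of x before
   M, and, again by induction, it assigns the same value.  Hence V^M_x(tr) can be
   read off any complete execution through M whose trace agrees with tr on
   prov(M,x). *)
Require Import Defs.
From mathcomp Require Import all_boot all_order all_algebra.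
From mathcomp Require Import boolp classical_sets reals.
From mathcomp Require Import zify.

Set Implicit Arguments.
Unset Strict Implicit.
Unset Printing Implicit Defensive.

Arguments IfBranch {A B}.
Arguments IfJoin {A B}.
Arguments IfThen {A B} a.
Arguments IfElse {A B} b.
Arguments WhileBranch {A} i.
Arguments WhileJoin {A}.
Arguments WhileBody {A} i a.

(** * Structural properties of control-flow graphs *)

Section Graph.
Context {R : realType} {L : builtins R} {X : finType}.
Implicit Types (H : cfg L X) (x y z : X).

Definition node_lt (T : Type) (lt : T -> T -> Prop) (u v : node T) : Prop :=
  match u, v with
  | START, START => False
  | START, _ => True
  | Inner a, Inner b => lt a b
  | Inner _, END => True
  | _, _ => False
  end.

(** The witness is a strict order rather than the absence of cycles: orders of subgraphs combine
    directly, and [node_lt] also forbids edges into [START] or out of [END]. *)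
Definition acyclic H : Prop :=
  exists lt : inner H -> inner H -> Prop,
    [/\ forall a, ~ lt a a,
        forall a b d, lt a b -> lt b d -> lt a d
      & forall u k v, edge H u k v -> node_lt lt u v].

(** Composite graphs forget the tag of an edge leaving [START] of a component. The first clause
    recovers it, so that the second can compare two such edges. *)
Definition deterministic H : Prop :=
  (forall k v, edge H START k v -> k = None) /\
  (forall u k v w, edge H u k v -> edge H u k w -> v = w).

(** Taking [J] from [branch_join] is what later places branch nodes in [BP]. *)
Definition postdominated H : Prop :=
  forall B E, lab B = LBranch E ->
    exists2 J : inner H, branch_join B J
      & ~ @path_via R L X H (fun u => u <> Inner J) (Inner B) END.

Lemma path_lt H (lt : inner H -> inner H -> Prop) P u v :
  (forall a b d, lt a b -> lt b d -> lt a d) ->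
  (forall u k v, edge H u k v -> node_lt lt u v) ->
  path_via P u v -> node_lt lt u v.
Proof.
move=> lt_trans edge_lt; elim=> {u v} [u k v /edge_lt //|u k w v].
move=> /edge_lt + _ _; case: u w v => [||a] [||b] [||d] //=.
exact: lt_trans.
Qed.

Lemma acyclic_path H P Q u v :
  acyclic H -> path_via P u v -> @path_via R L X H Q v u -> False.
Proof.
case=> lt [irr tr elt] /(path_lt tr elt) + /(path_lt tr elt).
case: u v => [||a] [||b] //= ab ba; exact: irr (tr _ _ _ ab ba).
Qed.

Lemma no_edge_to_start H u k : acyclic H -> ~ edge H u k START.
Proof. by case=> lt [_ _ elt] /elt; case: u. Qed.

Lemma no_edge_from_end H k v : acyclic H -> ~ edge H END k v.
Proof. by case=> lt [_ _ elt] /elt. Qed.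

(** * Acyclicity of each construction *)

Lemma acyclic_skip : acyclic (skip_cfg L X).
Proof. by exists (fun _ _ => False); split=> // u k v [-> _ ->]. Qed.

Lemma acyclic_single l : acyclic (single_cfg l).
Proof.
exists (fun _ _ => False); split=> [a|a b d|u k v e]; [by []|by []|].
by inversion e.
Qed.

Lemma acyclic_seq H1 H2 : acyclic H1 -> acyclic H2 -> acyclic (seq_cfg H1 H2).
Proof.
move=> [lt1 [irr1 tr1 elt1]] [lt2 [irr2 tr2 elt2]].
exists (fun m n => match m, n with
  | inl a, inl b => lt1 a b
  | inr a, inr b => lt2 a b
  | inl _, inr _ => True
  | inr _, inl _ => False
  end); split.
- by case.
- by move=> [a|a] [b|b] [d|d] //=; [exact: tr1|exact: tr2].
- move=> u k v [{}u {}k a /elt1|{}u {}k k' {}v /elt1 + /elt2|b {}k {}v /elt2].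
  + by case: u.
  + by case: u => [||?]; case: v.
  + by case: v.
Qed.

Lemma acyclic_if E H1 H2 : acyclic H1 -> acyclic H2 -> acyclic (if_cfg E H1 H2).
Proof.
move=> [lt1 [irr1 tr1 elt1]] [lt2 [irr2 tr2 elt2]].
exists (fun m n => match m, n with
  | IfThen a, IfThen b => lt1 a b
  | IfElse a, IfElse b => lt2 a b
  | IfBranch, IfBranch => False
  | IfBranch, _ => True
  | IfThen _, IfJoin => True
  | IfElse _, IfJoin => True
  | _, _ => False
  end); split.
- by case.
- by move=> [||a|a] [||b|b] [||d|d] //=; [exact: tr1|exact: tr2].
- move=> u k v [|{}k {}v /elt1|{}k {}v /elt2|a {}k {}v /elt1|a {}k {}v /elt2|] //;
  by case: v.
Qed.

(** Iterations are compared first, then positions inside one copy of the body; the branch node of an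
    iteration precedes its copy, and [WhileJoin] lies above everything else. *)
Lemma acyclic_while E H : acyclic H -> acyclic (while_cfg E H).
Proof.
move=> [lt [irr tr elt]].
exists (fun m n => match m, n with
  | WhileBranch i, WhileBranch j => is_true (i < j)%N
  | WhileBranch i, WhileBody j _ => is_true (i <= j)%N
  | WhileBody i _, WhileBranch j => is_true (i < j)%N
  | WhileBody i a, WhileBody j b => (i < j)%N \/ i = j /\ lt a b
  | WhileBranch _, WhileJoin => True
  | WhileBody _ _, WhileJoin => True
  | WhileJoin, _ => False
  end); split.
- move=> [i||i a] //=; first by rewrite ltnn.
  by case=> [|[_ /irr]//]; rewrite ltnn.
- move=> [i||i a] [j||j b] [m||m d] //=; try lia.
  move=> [ij|[-> ab]] [jm|[<- bd]]; try (left; lia).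
  by right; split=> //; exact: tr ab bd.
- move=> u k v [|i {}k {}v /elt|i|i a {}k {}v /elt|] //; case: v => [||b] //=.
  by right.
Qed.

(** * Determinism of each construction *)

Lemma deterministic_skip : deterministic (skip_cfg L X).
Proof. by split=> [k v [_ ->]//|u k v w [_ _ ->] [_ _ ->]]. Qed.

Lemma deterministic_single l : deterministic (single_cfg l).
Proof.
split=> [k v e|u k v w e1 e2]; first by inversion e.
by inversion e1; subst; inversion e2.
Qed.

Lemma seq_left_inj H1 H2 : injective (@seq_left R L X H1 H2).
Proof. by move=> [||a] [||b] //= [->]. Qed.

Lemma seq_edgeP H1 H2 u k w : edge (seq_cfg H1 H2) u k w ->
  (exists2 u1, u = seq_left H2 u1 &
     (exists2 a, edge H1 u1 k (Inner a) & w = Inner (inl a)) \/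
     edge H1 u1 k END /\ exists k' v, edge H2 START k' v /\ w = seq_right H1 v)
  \/ exists b v, [/\ u = Inner (inr b), edge H2 (Inner b) k v & w = seq_right H1 v].
Proof.
case=> [{}u {}k a e|{}u {}k k' v e1 e2|b {}k v e].
- by left; exists u => //; left; exists a.
- by left; exists u => //; right; split=> //; exists k', v.
- by right; exists b, v.
Qed.

Lemma deterministic_seq H1 H2 : acyclic H1 ->
  deterministic H1 -> deterministic H2 -> deterministic (seq_cfg H1 H2).
Proof.
move=> acy [st1 det1] [st2 det2]; split.
  move=> k v /seq_edgeP[[[||a] // _]|[b [w []]] //].
  by case=> [[b /st1//]|[/st1//]].
move=> u k v w /seq_edgeP[[u1 ->]|[b [v1 [-> e1 ->]]]].
  move=> e1 /seq_edgeP[[u2 /seq_left_inj<-]|[b [v2 [eq2 _ _]]]]; last first.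
    by case: u1 eq2 {e1}.
  case: e1 => [[a ea ->]|[ea [k1 [v1 [e1 ->]]]]].
    case=> [[b eb ->]|[eb _]]; last by have := det1 _ _ _ _ ea eb.
    by have [->] := det1 _ _ _ _ ea eb.
  case=> [[b eb _]|[eb [k2 [v2 [e2 ->]]]]]; first by have := det1 _ _ _ _ ea eb.
  have ek1 := st2 _ _ e1; have ek2 := st2 _ _ e2; subst.
  by rewrite (det2 _ _ _ _ e1 e2).
move=> /seq_edgeP[[u2 + _]|[b2 [v2 [[<-] e2 ->]]]]; first by case: u2.
by rewrite (det2 _ _ _ _ e1 e2).
Qed.

(** Inversion organised by the source node, the form in which both determinism and postdominance
    consume it. *)
Lemma if_edgeP E H1 H2 u k w : edge (if_cfg E H1 H2) u k w ->
  match u with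
  | START => k = None /\ w = Inner IfBranch
  | END => False
  | Inner IfBranch =>
      (k = Some true /\ exists k' v, edge H1 START k' v /\ w = if_then H2 v) \/
      (k = Some false /\ exists k' v, edge H2 START k' v /\ w = if_else H1 v)
  | Inner IfJoin => w = END
  | Inner (IfThen a) => exists2 v, edge H1 (Inner a) k v & w = if_then H2 v
  | Inner (IfElse b) => exists2 v, edge H2 (Inner b) k v & w = if_else H1 v
  end.
Proof.
case=> [|k' v e|k' v e|a k' v e|a k' v e|] //=.
- by left; split=> //; exists k', v.
- by right; split=> //; exists k', v.
- by exists v.
- by exists v.
Qed.

Lemma deterministic_if E H1 H2 :
  deterministic H1 -> deterministic H2 -> deterministic (if_cfg E H1 H2).
Proof.
move=> [st1 det1] [st2 det2]; split; first by move=> k v /if_edgeP[].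
move=> u k v w /if_edgeP + /if_edgeP.
case: u => [[_ ->] [_ ->]//|//|[||a|a]].
- move=> [[-> [k1 [v1 [e1 ->]]]]|[-> [k1 [v1 [e1 ->]]]]] [[// _]|[// _]];
  case=> k2 [v2 [e2 ->]].
  + have ek1 := st1 _ _ e1; have ek2 := st1 _ _ e2; subst.
    by rewrite (det1 _ _ _ _ e1 e2).
  + have ek1 := st2 _ _ e1; have ek2 := st2 _ _ e2; subst.
    by rewrite (det2 _ _ _ _ e1 e2).
- by move=> -> ->.
- by move=> [v1 e1 ->] [v2 e2 ->]; rewrite (det1 _ _ _ _ e1 e2).
- by move=> [v1 e1 ->] [v2 e2 ->]; rewrite (det2 _ _ _ _ e1 e2).
Qed.

Lemma while_edgeP E H u k w : edge (while_cfg E H) u k w ->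
  match u with
  | START => k = None /\ w = Inner (WhileBranch 0)
  | END => False
  | Inner (WhileBranch i) =>
      (k = Some true /\ exists k' v, edge H START k' v /\ w = while_copy i v) \/
      (k = Some false /\ w = Inner WhileJoin)
  | Inner WhileJoin => w = END
  | Inner (WhileBody i a) => exists2 v, edge H (Inner a) k v & w = while_copy i v
  end.
Proof.
case=> [|i k' v e|i|i a k' v e|] //=.
- by left; split=> //; exists k', v.
- by right.
- by exists v.
Qed.

Lemma deterministic_while E H : deterministic H -> deterministic (while_cfg E H).
Proof.
move=> [st det]; split; first by move=> k v /while_edgeP[].
move=> u k v w /while_edgeP + /while_edgeP.
case: u => [[_ ->] [_ ->]//|//|[i||i a]].
- move=> [[-> [k1 [v1 [e1 ->]]]]|[-> ->]] [[// _]|[// _ -> //]].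
  case=> k2 [v2 [e2 ->]].
  have ek1 := st _ _ e1; have ek2 := st _ _ e2; subst.
  by rewrite (det _ _ _ _ e1 e2).
- by move=> -> ->.
- by move=> [v1 e1 ->] [v2 e2 ->]; rewrite (det _ _ _ _ e1 e2).
Qed.

(** * Postdominance of branch nodes by join nodes *)

(* A path in G that starts in a copy of H and ends at END must leave the copy,
   and it can only do so where H itself reaches END. *)
Lemma path_restrict H G (f : inner H -> inner G) (J a : inner H) :
  (forall b k w, edge G (Inner (f b)) k w ->
     edge H (Inner b) k END \/
     exists2 d, edge H (Inner b) k (Inner d) & w = Inner (f d)) ->
  @path_via R L X G (fun u => u <> Inner (f J)) (Inner (f a)) END ->
  @path_via R L X H (fun u => u <> Inner J) (Inner a) END.
Proof.
move=> stay p.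
move: {-2}(Inner (f a)) {-2}END p (erefl (Inner (f a))) (erefl (@END (inner G))).
move=> u v p; elim: p a => {u v} [u k v e|u k w v e nJ _ IH] a eu ev; subst.
- by case: (stay _ _ _ e) => [/PathEdge|[d]].
- case: (stay _ _ _ e) => [/PathEdge|[d ed ew]] //.
  by apply: (PathCons ed); [move=> -[dJ]; apply: nJ; rewrite ew dJ|exact: IH].
Qed.

(** On a path with more than one edge, the last node before [END] would be [J] as a forbidden
    intermediate node. *)
Lemma path_to_end_via H (J : inner H) u :
  (forall v k, edge H v k END -> v = Inner J) ->
  @path_via R L X H (fun u => u <> Inner J) u END -> u = Inner J.
Proof.
move=> only p; move: {-2}END p (erefl (@END (inner H))) => v p.
elim: p => {u v} [u k v e ev|u k w v _ nJ _ IH /IH //].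
by rewrite -ev in e; exact: only e.
Qed.

Lemma postdominated_seq H1 H2 : acyclic H2 ->
  postdominated H1 -> postdominated H2 -> postdominated (seq_cfg H1 H2).
Proof.
move=> acy2 pd1 pd2 [B|B] E /=.
- move=> /pd1[J bj np]; exists (inl J); first exact: SeqBJLeft.
  move=> /(@path_restrict H1 (seq_cfg H1 H2) inl) p; apply/np/p.
  move=> b k w /seq_edgeP[[[||u1] // [->] [[a ea ->]|[? _]]]|[? [? []]]//].
    by right; exists a.
  by left.
- move=> /pd2[J bj np]; exists (inr J); first exact: SeqBJRight.
  move=> /(@path_restrict H2 (seq_cfg H1 H2) inr) p; apply/np/p.
  move=> b k w /seq_edgeP[[[||u1] //]|[? [v [[->] e ->]]]].
  (* [START] of the second graph is not among the copied nodes, but acyclicity leaves no edge into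
     it. *)
  case: v e => [/no_edge_to_start//|e|d e]; [by left|by right; exists d].
Qed.

Lemma postdominated_if E H1 H2 : acyclic H1 -> acyclic H2 ->
  postdominated H1 -> postdominated H2 -> postdominated (if_cfg E H1 H2).
Proof.
move=> acy1 acy2 pd1 pd2 [||B|B] E' //=.
- move=> _; exists IfJoin; first exact: IfBJ.
  move=> p; suff: @Inner (inner (if_cfg E H1 H2)) IfBranch = Inner IfJoin by [].
  apply: path_to_end_via p => v k /if_edgeP.
  case: v => [[]//|//|[||a|a]] //.
  + by case=> [[_ [? [[||?] []]]]|[_ [? [[||?] []]]]].
  + by case=> [[||?]].
  + by case=> [[||?]].
- move=> /pd1[J bj np]; exists (IfThen J); first exact: IfBJThen.
  move=> /(@path_restrict H1 (if_cfg E H1 H2) IfThen) p; apply/np/p.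
  move=> b k w /if_edgeP[[/no_edge_to_start//|e _|d e ->]]; first by left.
  by right; exists d.
- move=> /pd2[J bj np]; exists (IfElse J); first exact: IfBJElse.
  move=> /(@path_restrict H2 (if_cfg E H1 H2) IfElse) p; apply/np/p.
  move=> b k w /if_edgeP[[/no_edge_to_start//|e _|d e ->]]; first by left.
  by right; exists d.
Qed.

Lemma postdominated_while E H : acyclic H ->
  postdominated H -> postdominated (while_cfg E H).
Proof.
move=> acy pd [i||i B] E' //=.
- move=> _; exists WhileJoin; first exact: WhileBJ.
  (* Paths are finite, so endless iteration does not count, and the only edge into [END] starts at
     the shared [WhileJoin]. *)
  move=> p; suff: @Inner (inner (while_cfg E H)) (WhileBranch i) = Inner WhileJoin by [].
  apply: path_to_end_via p => v k /while_edgeP.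
  case: v => [[]//|//|[j||j a]] //.
  + by case=> [[_ [? [[||?] []]]]|[]].
  + by case=> [[||?]].
- move=> /pd[J bj np]; exists (WhileBody i J); first exact: WhileBJBody.
  move=> /(@path_restrict H (while_cfg E H) (WhileBody i)) p; apply/np/p.
  move=> b k w /while_edgeP[[/no_edge_to_start//|e _|d e ->]]; first by left.
  by right; exists d.
Qed.

(** * The three properties for unrolled graphs *)

Lemma unrolled_acyclic (S : stmt L X) : acyclic (unrolled_cfg S).
Proof.
elim: S => [x E|S1 a1 S2 a2|E S1 a1 S2 a2||E S a|x E f Es] /=.
- exact: acyclic_single.
- exact: acyclic_seq.
- exact: acyclic_if.
- exact: acyclic_skip.
- exact: acyclic_while.
- exact: acyclic_single.
Qed.

Lemma unrolled_deterministic (S : stmt L X) : deterministic (unrolled_cfg S).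
Proof.
elim: S => [x E|S1 d1 S2 d2|E S1 d1 S2 d2||E S d|x E f Es] /=.
- exact: deterministic_single.
- exact: deterministic_seq (unrolled_acyclic S1) d1 d2.
- exact: deterministic_if.
- exact: deterministic_skip.
- exact: deterministic_while.
- exact: deterministic_single.
Qed.

Lemma unrolled_postdominated (S : stmt L X) : postdominated (unrolled_cfg S).
Proof.
elim: S => [x E|S1 p1 S2 p2|E S1 p1 S2 p2||E S p|x E f Es] //=.
- exact: postdominated_seq (unrolled_acyclic S2) p1 p2.
- exact: postdominated_if (unrolled_acyclic S1) (unrolled_acyclic S2) p1 p2.
- exact: postdominated_while (unrolled_acyclic S) p.
Qed.

End Graph.

(** * Dependence of single steps on state and trace *)

Section Executions.
Context {R : realType} {L : builtins R} {X : finType} {H : cfg L X}.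
Implicit Types (x y z : X) (tr : trace R) (c d : state R X * node (inner H)).
Implicit Types run : nat -> state R X * node (inner H).

Lemma eval_ext (s s' : state R X) (E : expr L X) :
  (forall y, vars E y -> store s y = store s' y) -> eval s E = eval s' E.
Proof.
elim: E => [v|y|g Es IH] eq_s //=; first exact: eq_s.
congr fsem; apply: eq_from_tnth => i; rewrite !tnth_mktuple.
by apply: IH => y Ey; apply: eq_s; exists i.
Qed.

(** Derivations of [prov_rel] compose, so agreement of traces on the provenance of (M, x) passes to
    every pair related to it. *)
Lemma prov_sub (M N : node (inner H)) x y alpha :
  prov_rel M x N y -> prov N y alpha -> prov M x alpha.
Proof.
move=> MN [P [z [A [NP rd ad]]]]; exists P, z, A; split=> //.
elim: NP => {P z A rd ad} [//|P z A w _ MP rd|P z A B w _ MP rd].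
- exact: ProvAssign MP rd.
- exact: ProvBranch MP rd.
Qed.

Lemma step_cases tr c d : step tr c d ->
  (exists B E b, [/\ c.2 = Inner B, lab B = LBranch E, eval c.1 E = VBool b
     & edge H (Inner B) (Some b) d.2])
  \/ edge H c.2 None d.2 /\ forall B E, c.2 = Inner B -> lab B <> LBranch E.
Proof.
case=> [s v e|s n v lb e|s n x E v lb e|s n x E f Es a v lb e|s n E b v lb e ev].
- by right.
- by right; split=> // B E [<-]; rewrite lb.
- by right; split=> // B E' [<-]; rewrite lb.
- by right; split=> // B E' [<-]; rewrite lb.
- by left; exists n, E, b.
Qed.

Lemma step_edge tr c d : step tr c d -> exists k, edge H c.2 k d.2.
Proof.
case/step_cases=> [[B [E [b [-> _ _ e]]]]|[e _]]; first by exists (Some b).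
by exists None.
Qed.

(** At a common node, distinct successors need distinct edge tags, and only at branch nodes does the
    tag depend on the state. *)
Lemma step_diverge tr tr' c d c' d' : deterministic H ->
  step tr c d -> step tr' c' d' -> c.2 = c'.2 -> d.2 <> d'.2 ->
  exists B E, [/\ c.2 = Inner B, lab B = LBranch E & eval c.1 E <> eval c'.1 E].
Proof.
move=> [_ det] /step_cases st /step_cases st' eq_c neq_d.
case: st => [[B [E [b [cB lB ev e]]]]|[e nb]].
  exists B, E; split=> // eq_ev.
  case: st' => [[B' [E' [b' [cB' lB' ev' e']]]]|[_ nb]]; last first.
    by case: (nb B E); rewrite -?eq_c.
  move: cB'; rewrite -eq_c cB => -[eB]; subst B'.
  move: lB' ev'; rewrite lB => -[eE]; subst E'; rewrite -eq_ev ev => -[eb]; subst b'.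
  exact/neq_d/(det _ _ _ _ e e').
case: st' => [[B' [E' [b' [cB' lB' _ _]]]]|[e' _]].
  by case: (nb B' E'); rewrite ?eq_c.
by rewrite -eq_c in e'; case: neq_d; exact: det e e'.
Qed.

Lemma step_frame tr c d x :
  step tr c d -> ~ assigns x c.2 -> store d.1 x = store c.1 x.
Proof.
by case=> [//|//|s n y E v lb _|s n y E f Es a v lb _ _ _ _|//] /=;
  rewrite lb /upd; case: eqP => // ->.
Qed.

Lemma step_assign tr tr' c d c' d' x N :
  step tr c d -> step tr' c' d' -> c.2 = Inner N -> c'.2 = Inner N ->
  assigns x (Inner N) ->
  (forall y, used_vars N y -> store c.1 y = store c'.1 y) ->
  (forall alpha, addresses N alpha -> tr alpha = tr' alpha) ->
  store d.1 x = store d'.1 x.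
Proof.
rewrite /= /used_vars /addresses /=.
case=> [//|s n v lb _|s n y E v lb _|s n y E f Es a v lb _ ev _ _|s n E b v lb _ _]
  /= st' [nN]; subst n; rewrite lb //.
- case: st' => [//|s' n v' lb' _|s' n y' E' v' lb' _
    |s' n y' E' f' Es' a' v' lb' _ ev' _ _|s' n E' b' v' lb' _ _]
    /= [nN]; subst n; rewrite lb' // in lb *.
  case: lb => -> -> -> eq_s _; rewrite /upd eqxx; exact: eval_ext.
- case: st' => [//|s' n v' lb' _|s' n y' E' v' lb' _
    |s' n y' E' f' Es' a' v' lb' _ ev' _ _|s' n E' b' v' lb' _ _]
    /= [nN]; subst n; rewrite lb' // in lb *.
  case: lb => ? ? _ _ yx eq_s eq_tr; subst; rewrite /upd eqxx.
  have := eval_ext eq_s; rewrite ev ev' => -[->].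
  (* The state of the second step itself witnesses that the common address belongs to
     [addresses N]. *)
  by apply: eq_tr; exists s'.
Qed.

(** * Comparison of two executions *)

Lemma run_path (P : node (inner H) -> Prop) tr l run i j :
  execution tr l run -> (i < j)%N -> (j <= l)%N ->
  (forall m, (i < m < j)%N -> P (run m).2) -> path_via P (run i).2 (run j).2.
Proof.
case=> _ st _ + jl; have [n] := ubnP (j - i).
elim: n i => // n IH i bnd ij Pm.
have [k e] : exists k, edge H (run i).2 k (run i.+1).2.
  by apply: step_edge (st i _); lia.
have [ij'|ij'] := ltnP i.+1 j; last first.
  have -> : j = i.+1 by lia.
  exact: PathEdge e.
apply: (PathCons e); first by apply: Pm; lia.
by apply: IH => //; [lia|move=> m ?; apply: Pm; lia].
Qed.

(** Otherwise the second run would lead back from the later node to the earlier one, or the two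
    would coincide; either closes a cycle. *)
Lemma run_order tr l run tr' l' run' i j i' j' : acyclic H ->
  execution tr l run -> execution tr' l' run' ->
  (run i).2 = (run' i').2 -> (run j).2 = (run' j').2 ->
  (i < j)%N -> (j <= l)%N -> (i' <= l')%N -> (i' < j')%N.
Proof.
move=> acy ex ex' eqi eqj ij jl il'; rewrite ltnNge; apply/negP => ji'.
have p : path_via (fun=> True) (run i).2 (run j).2 by exact: run_path ex _ _ _.
have [eq_ij|ji] := eqVneq j' i'.
  by apply: (acyclic_path acy p); move: p; rewrite eqi eqj eq_ij; apply.
apply: (acyclic_path acy p); rewrite eqi eqj.
by apply: (run_path (P := fun=> True) ex') => //; lia.
Qed.

(* In the proof, B is the last node before N that the second run also visits. *)
Lemma divergence tr l run tr' l' run' i N :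
  acyclic H -> deterministic H -> postdominated H ->
  execution tr l run -> execution tr' l' run' ->
  (i <= l)%N -> (run i).2 = Inner N ->
  (forall j, (j <= l')%N -> (run' j).2 <> Inner N) ->
  exists k k' B E, [/\ (k < i)%N, (k' <= l')%N, (run k).2 = Inner B,
    (run' k').2 = Inner B & [/\ BP (Inner N) B, lab B = LBranch E
    & eval (run k).1 E <> eval (run' k').1 E]].
Proof.
move=> acy det pd ex ex' il runN nvisit.
have [r0 st rl] := ex; have [r0' st' rl'] := ex'.
pose common k := (k <= i)%N &&
  `[< exists2 k', (k' <= l')%N & (run' k').2 = (run k).2 >].
have common0 : exists k, common k.
  exists 0%N; apply/andP; split=> //; apply/asboolP; exists 0%N => //.
  by rewrite r0 r0'.
have bound k : common k -> (k <= i)%N by case/andP.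
case: (ex_maxnP common0 bound) => k /andP[ki /asboolP[k' kl' eqk]] kmax.
have {}ki : (k < i)%N.
  rewrite ltn_neqAle ki andbT; apply/eqP => eq_ki.
  by apply: (nvisit k') => //; rewrite eqk eq_ki.
have k_st := st k (leq_trans ki il).
have {}kl' : (k' < l')%N.
  rewrite ltn_neqAle kl' andbT; apply/eqP => eq_kl.
  have [t e] := step_edge k_st.
  by move: e; rewrite -eqk eq_kl rl' => /(no_edge_from_end acy).
(* Equal successors would make [k.+1] common too, against the maximality of [k]. *)
have [|B [E [kB lB nev]]] := step_diverge det k_st (st' _ kl') (esym eqk).
  move=> eqS; have /kmax : common k.+1; last by rewrite ltnn.
  by apply/andP; split=> //; apply/asboolP; exists k'.+1.
have kB' : (run' k').2 = Inner B by rewrite eqk.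
have [J bj np] := pd _ _ lB.
(* Both runs reach [END], so by postdominance each of them meets [J] after [B]. *)
have later tr0 l0 run0 k0 : execution tr0 l0 run0 -> (k0 < l0)%N ->
    (run0 k0).2 = Inner B ->
    exists j, [/\ (k0 < j)%N, (j <= l0)%N & (run0 j).2 = Inner J].
  move=> ex0 kl0 k0B; apply: contrapT => none; apply: np.
  have [_ _ e0] := ex0; rewrite -k0B -e0.
  apply: (run_path ex0) => // m mkl mJ; apply: none; exists m.
  by split=> //; lia.
have [j [kj jl jJ]] := later _ _ _ _ ex (leq_trans ki il) kB.
have [j' [_ jl' jJ']] := later _ _ _ _ ex' kl' kB'.
(* The second run also visits [J]; if the first met it by position [i], then [j] would be a common
   position beyond [k]. Hence N lies between [B] and [J]. *)
have ij : (i < j)%N.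
  rewrite ltnNge; apply/negP => ji; have /kmax : common j; last by lia.
  by rewrite /common ji; apply/asboolP; exists j' => //; rewrite jJ'.
exists k, k', B, E; split=> //; [exact: ltnW|split=> //].
exists J; split=> //.
- by rewrite -kB -runN; apply: (run_path ex).
- by rewrite -jJ -runN; apply: (run_path ex).
Qed.

(** In the first alternative the initial [VNull] survives; in the second, [k] is the latest
    assignment and [step_frame] carries its value up to [i]. *)
Lemma last_assign tr l run i x : execution tr l run -> (i <= l)%N ->
  (store (run i).1 x = VNull /\ forall k, (k < i)%N -> ~ assigns x (run k).2)
  \/ exists k, [/\ (k < i)%N, assigns x (run k).2,
       forall m, (k < m < i)%N -> ~ assigns x (run m).2
     & store (run i).1 x = store (run k.+1).1 x].
Proof.
case=> r0 st _; elim: i => [_|i IH il]; first by left; rewrite r0.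
have [asg|nasg] := pselect (assigns x (run i).2).
  by right; exists i; split=> // m; lia.
rewrite (step_frame (st i il) nasg).
have nasgS (k m : nat) : (forall m, (k <= m < i)%N -> ~ assigns x (run m).2) ->
    (k <= m < i.+1)%N -> ~ assigns x (run m).2.
  move=> nlt /andP[km]; rewrite ltnS leq_eqVlt => /predU1P[-> //|mi].
  by apply: nlt; rewrite km.
case: (IH (ltnW il)) => [[-> none]|[k [ki asg none ->]]]; [left|right].
  by split=> // k ki; apply: (nasgS 0%N) => // m; exact: none.
by exists k; split=> //; [exact: ltnW|move=> m; exact: nasgS].
Qed.

(** Let N be the node at [k] and M the common node. If the second run missed N, [divergence] would
    give a branch in BP of N with differing conditions. But N is a reaching definition of x at M, so
    [ProvBranch] relates the variables of that condition to (M, x), and the agreement hypothesis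
    equates their values. *)
Lemma assign_visited tr l run tr' l' run' i j k x :
  acyclic H -> deterministic H -> postdominated H ->
  execution tr l run -> execution tr' l' run' ->
  (i <= l)%N -> (j <= l')%N -> (run i).2 = (run' j).2 ->
  (k < i)%N -> assigns x (run k).2 ->
  (forall m, (k < m < i)%N -> ~ assigns x (run m).2) ->
  (forall m m' y, (m < i)%N -> (m' <= l')%N -> (run m).2 = (run' m').2 ->
     prov_rel (run i).2 x (run m).2 y ->
     store (run m).1 y = store (run' m').1 y) ->
  exists2 k', (k' < j)%N & (run' k').2 = (run k).2.
Proof.
move=> acy det pd ex ex' il jl' eqM ki asg none agree.
have [N kN] : exists N, (run k).2 = Inner N by case: (run k).2 asg => // N; exists N.
suff [k' kl' eqk] : exists2 k', (k' <= l')%N & (run' k').2 = (run k).2.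
  by exists k' => //; exact: (run_order acy ex ex' (esym eqk) eqM).
apply: contrapT => nvisit.
have [|m [m' [B [E [mk ml' mB mB' [bp lB nev]]]]]] :=
    divergence acy det pd ex ex' (leq_trans (ltnW ki) il) kN.
  by move=> k' kl' eqk; apply: nvisit; exists k' => //; rewrite kN.
apply: nev; apply: eval_ext => y Ey; apply: agree => //; first lia.
  by rewrite mB.
rewrite mB; apply: (ProvBranch (ProvBase _ _) _ bp); last first.
  by rewrite /cond_vars lB.
by split; rewrite -kN //; exact: run_path ex ki il none.
Qed.

Lemma store_determined tr l run tr' l' run' i j x :
  acyclic H -> deterministic H -> postdominated H ->
  execution tr l run -> execution tr' l' run' ->
  (i <= l)%N -> (j <= l')%N -> (run i).2 = (run' j).2 ->
  (forall alpha, prov (run i).2 x alpha -> tr alpha = tr' alpha) ->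
  store (run i).1 x = store (run' j).1 x.
Proof.
move=> acy det pd ex ex'; have [n] := ubnP i.
elim: n i j x => // n IH i j x lin il jl' eqM eq_tr.
(* The induction hypothesis applies to related pairs because [prov_sub] bounds their provenance. *)
have agree m m' y : (m < i)%N -> (m' <= l')%N -> (run m).2 = (run' m').2 ->
    prov_rel (run i).2 x (run m).2 y ->
    store (run m).1 y = store (run' m').1 y.
  move=> mi ml' eqm pr; apply: IH => //; try lia.
  by move=> alpha /(prov_sub pr); exact: eq_tr.
(* The mirrored form: the induction runs over positions of the first run, so [run_order] is needed
   to turn [m' < j] into [m < i]. *)
have agree' m' m y : (m' < j)%N -> (m <= l)%N -> (run' m').2 = (run m).2 ->
    prov_rel (run' j).2 x (run' m').2 y ->
    store (run' m').1 y = store (run m).1 y.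
  move=> mj ml eqm pr; apply/esym/agree => //; last by rewrite -eqm eqM.
  - by apply: (run_order acy ex' ex eqm (esym eqM)).
  - lia.
have [[-> none]|[k [ki asg none ->]]] := last_assign x ex il.
  have [[-> //]|[k' [kj' asg' none' _]]] := last_assign x ex' jl'.
  have [k ki eqk] := assign_visited acy det pd ex' ex jl' il (esym eqM)
    kj' asg' none' agree'.
  by case: (none k ki); rewrite eqk.
have [k1' k1j eqk1'] :=
  assign_visited acy det pd ex ex' il jl' eqM ki asg none agree.
have [[_ none']|[k' [kj' asg' none' ->]]] := last_assign x ex' jl'.
  by case: (none' _ k1j); rewrite eqk1'.
have [k1 k1i eqk1] := assign_visited acy det pd ex' ex jl' il (esym eqM)
  kj' asg' none' agree'.
have k1k : (k1 <= k)%N.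
  rewrite leqNgt; apply/negP => kk1; apply: (none k1); first by rewrite kk1.
  by rewrite eqk1.
have k1k' : (k1' <= k')%N.
  rewrite leqNgt; apply/negP => kk1; apply: (none' k1'); first by rewrite kk1.
  by rewrite eqk1'.
(* [k1] before [k] in the first run would force [k'] before [k1'] in the second, although [k'] is
   the last assignment there. *)
have eqk : k1 = k.
  apply/eqP; rewrite eqn_leq k1k leqNgt; apply/negP => lt_k1k.
  have := run_order acy ex ex' eqk1 (esym eqk1') lt_k1k; lia.
subst k1; have [N kN] : exists N, (run k).2 = Inner N.
  by case: (run k).2 asg => // N; exists N.
have [_ st _] := ex; have [_ st' _] := ex'.
have rd : RD (run i).2 x N.
  by split; rewrite -kN //; exact: run_path ex ki il none.
apply: (step_assign (st k _) (st' k' _) kN) => //; try lia.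
- by rewrite -eqk1.
- by rewrite -kN.
- move=> y Ny; apply: agree => //; first lia.
  by rewrite kN; exact: ProvAssign (ProvBase _ _) rd Ny.
- by move=> alpha ad; apply: eq_tr; exists (run i).2, x, N; split=> //; exact: ProvBase.
Qed.

End Executions.

(** * Choice of the evaluation functions *)

Definition pick_value (R : realType) (A : set (value R)) : value R :=
  if pselect (exists v, A v) is left ex then projT1 (cid ex) else VNull.

Lemma pick_valueP (R : realType) (A : set (value R)) v : A v -> A (pick_value A).
Proof.
rewrite /pick_value => Av; case: pselect => [ex|[]]; last by exists v.
exact: projT2 (cid ex).
Qed.

(** Ranging over all traces that agree with [tr] on the provenance, and not over [tr] alone, makes
    this set depend only on the restriction of [tr]. *)
Definition reachable_values (R : realType) (L : builtins R) (X : finType)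
    (H : cfg L X) (M : node (inner H)) (x : X) (tr : trace R) : set (value R) :=
  [set v | exists tr' l run i,
     [/\ execution tr' l run, (i <= l)%N, (run i).2 = M,
         forall alpha, prov M x alpha -> tr' alpha = tr alpha
       & v = store (run i).1 x]].

Theorem proposition4 (R : realType) (L : builtins R) (X : finType)
    (S : stmt L X) :
  exists V : node (inner (unrolled_cfg S)) -> X -> trace R -> value R,
    (forall (M : node (inner (unrolled_cfg S))) (x : X),
       restricted_fun (prov M x) (V M x)) /\
    (forall (tr : trace R) (l : nat)
        (c : nat -> state R X * node (inner (unrolled_cfg S))),
       execution tr l c ->
       forall (i : nat) (x : X), (i <= l)%N ->
         store (c i).1 x = V (c i).2 x tr).
Proof.
exists (fun M x tr => pick_value (reachable_values M x tr)); split.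
  move=> M x tr tr' eq_tr; congr pick_value; apply/predeqP => v.
  split=> -[tr0 [l [run [i [ex il runM eq0 ->]]]]]; exists tr0, l, run, i;
    by split=> // alpha pa; rewrite eq0 // eq_tr.
move=> tr l c ex i x il.
(* The given execution shows the set to be nonempty; the value picked may stem from another
   execution, which [store_determined] then compares with it. *)
have /pick_valueP[tr' [l' [run [j [ex' jl' eqM eq_tr ->]]]]] :
    reachable_values (c i).2 x tr (store (c i).1 x).
  by exists tr, l, c, i.
apply: store_determined ex ex' il jl' (esym eqM) _.
- exact: unrolled_acyclic.
- exact: unrolled_deterministic.
- exact: unrolled_postdominated.
- by move=> alpha pa; rewrite eq_tr.
Qed.
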